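(* Let $M$ be a commutative monoid and $a \in M$ with $\mathrm{sr}_M(a) = n < \infty$. Then $$1 + \left\lfloor \frac{n-1}{l} \right\rfloor \le \mathrm{sr}_M(la) \le 1 + \left\lceil \frac{n-1}{l} \right\rceil$$ for all positive integers $l$. Further, $\mathrm{sr}_M(la) = 1 + \left\lceil \frac{n-1}{l} \right\rceil$ for all positive integers $l$ in case $M$ is a refinement monoid.
   Context: All monoids are commutative and written additively. For a monoid $M$ and $a \in M$, the stable rank $\mathrm{sr}_M(a) \in \mathbb{Z}_{>0} \cup \{\infty\}$ is the least positive integer $n$ such that: for all $x,y \in M$ with $na + x = a + y$ there exists $e \in M$ with $na = a + e$ and $e + x = y$. If no such $n$ exists, $\mathrm{sr}_M(a) = \infty$. $M$ is a refinement monoid if whenever $x_1 + x_2 = y_1 + y_2$ in $M$, there exist $z_{ij} \in M$ ($i,j \in \{1,2\}$) such that $x_i = z_{i1} + z_{i2}$ for $i = 1,2$ and $y_j = z_{1j} + z_{2j}$ for $j = 1,2$. *)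

(* Defs.v *)
From HB Require Import structures.
From mathcomp Require Import all_boot all_order all_algebra.
From mathcomp Require Import boolp constructive_ereal.

Set Implicit Arguments.
Unset Strict Implicit.
Unset Printing Implicit Defensive.

Import Order.TTheory GRing.Theory Num.Theory.

Local Open Scope ring_scope.

(* Commutative additive monoids are nmodTypes; the choice structure they bundle
   is available on every type classically. *)
Definition sr_cond (M : nmodType) (a : M) (n : nat) : Prop :=
  forall x y : M, a *+ n + x = a + y ->
    exists e : M, a *+ n = a + e /\ e + x = y.

(* The values are positive integers or +oo; -oo is never taken. *)
Definition sr (M : nmodType) (a : M) : \bar int :=
  match pselect (exists n : nat, `[< (0 < n)%N /\ sr_cond a n >]) with
  | left exn => ((ex_minn exn)%:Z)%:E
  | right _ => +oo%E
  end.

Definition refinement_monoid (M : nmodType) : Prop :=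
  forall x1 x2 y1 y2 : M, x1 + x2 = y1 + y2 ->
    exists z11 z12 z21 z22 : M,
      [/\ x1 = z11 + z12, x2 = z21 + z22, y1 = z11 + z21 & y2 = z12 + z22].

Lemma sr_finP (M : nmodType) (a : M) (n : nat) :
  sr a = n%:Z%:E <->
  [/\ (0 < n)%N, sr_cond a n
    & forall m : nat, (0 < m)%N -> sr_cond a m -> (n <= m)%N].
Proof.
rewrite /sr; case: pselect => [exn|nex]; last first.
  by split=> [//|[n0 cn _]]; case: nex; exists n; apply/asboolP.
case: ex_minnP => m /asboolP[m0 cm] minm; split=> [[<-]|[n0 cn minn]].
  by split=> // k k0 ck; apply: minm; apply/asboolP.
suff -> : m = n by [].
by apply/eqP; rewrite eqn_leq minn // andbT; apply: minm; apply/asboolP.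
Qed.

Lemma sr_pinftyP (M : nmodType) (a : M) :
  sr a = +oo%E <-> ~ exists n : nat, (0 < n)%N /\ sr_cond a n.
Proof.
rewrite /sr; case: pselect => [exn|nex]; split=> //.
  by case; case: exn => n /asboolP Hn; exists n.
by move=> _ [n Hn]; case: nex; exists n; apply/asboolP.
Qed.

(* Main.v *)
(* Write S(b, m) for the condition defining sr(b) <= m; it is upward closed
   in m.  Cancelling l copies of a one at a time shows that S(a, ql + 1)
   implies S(la, q + 1), which is the upper bound.  Adding (l - 1)a to both
   sides of (ml)a + x = a + y shows that S(la, m) implies S(a, ml), which is
   the lower bound.  Under refinement, S(la, q + 1) even implies S(a, ql + 1):
   refining (ql + 1)a + x = a + y reduces to the case where a = a1 + x and
   (ql + 1)a = a1 + y, and then any e with e + x = y automatically satisfies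
   a + e = a1 + x + e = (ql + 1)a. *)

Require Import Defs.
From HB Require Import structures.
From mathcomp Require Import all_boot all_order all_algebra.
From mathcomp Require Import boolp constructive_ereal.

Set Implicit Arguments.
Unset Strict Implicit.
Unset Printing Implicit Defensive.

Import Order.TTheory GRing.Theory Num.Theory.

Local Open Scope ring_scope.

Lemma sr_cond_leq (M : nmodType) (a : M) (m n : nat) :
  (n <= m)%N -> sr_cond a n -> sr_cond a m.
Proof.
move=> /subnK <- can x y; rewrite addnC mulrnDr -addrA => /can[e [ea exy]].
by exists (e + a *+ (m - n)); rewrite {1}ea addrA -exy addrA.
Qed.

Lemma sr_cond_cancel_mul (M : nmodType) (a : M) (k l : nat) (x y : M) :
  sr_cond a k.+1 -> (0 < l)%N -> a *+ (k + l) + x = a *+ l + y ->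
  exists e : M, a *+ (k + l) = a *+ l + e /\ e + x = y.
Proof.
move=> ca; case: l => // l _; elim: l x y => [|l IHl] x y.
  by rewrite addn1; exact: ca.
rewrite -addSnnS mulrnDr -addrA [a *+ l.+2]mulrS -addrA => /ca[e1 [ea1]].
(* One of the [l.+1] copies of [a] turns [e1] into [a *+ k.+1], so the induction hypothesis applies,
   and its [e] serves here too. *)
have -> : e1 + (a *+ l.+1 + x) = a *+ (k + l.+1) + x.
  by rewrite -addSnnS mulrnDr ea1 mulrS !addrA [e1 + a]addrC.
case/IHl=> e [ea exy]; exists e; split=> //.
by rewrite -mulrnDr addSn mulrS ea addrA.
Qed.

Lemma sr_cond_mulrn (M : nmodType) (a : M) (l q : nat) :
  (0 < l)%N -> sr_cond a (q * l).+1 -> sr_cond (a *+ l) q.+1.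
Proof.
move=> l0 ca x y; rewrite -mulrnA mulnC mulSn addnC.
exact: sr_cond_cancel_mul.
Qed.

Lemma sr_cond_of_mulrn (M : nmodType) (a : M) (l m : nat) :
  (0 < l)%N -> sr_cond (a *+ l) m -> sr_cond a (m * l).
Proof.
case: l => // l _ cla x y eqxy.
(* Here [l] is one less than the original multiplier; the added [a *+ l] reappears in the
   witness. *)
have : a *+ l.+1 *+ m + (a *+ l + x) = a *+ l.+1 + y.
  by rewrite -mulrnA mulnC addrCA eqxy mulrSr addrA.
case/cla=> e [ea exy]; exists (e + a *+ l); split.
  by rewrite mulnC mulrnA ea mulrS -addrA [e + _]addrC.
by rewrite -addrA.
Qed.

Lemma refinement_sr_cond_of_mulrn (M : nmodType) (a : M) (l q : nat) :
  refinement_monoid M -> (0 < l)%N ->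
  sr_cond (a *+ l) q.+1 -> sr_cond a (q * l).+1.
Proof.
move=> refM; case: l => // l _ cla x y /refM[a1 [b1 [a2 [x2]]]].
move=> [kab xE aE ->].
(* Since [x = a2 + x2] and [y = b1 + x2] share [x2], an [e] with [e + a2 = b1] is sought. *)
have ab : a *+ (q * l.+1).+1 + a2 = a + b1 by rewrite kab addrAC -aE.
have : a *+ l.+1 *+ q.+1 + a2 = a *+ l.+1 + b1.
  rewrite -mulrnA mulnC mulSn addSnnS mulrnDr -addrA ab.
  by rewrite addrA -mulrSr.
case/cla=> e [_ eab]; exists e; split; last by rewrite xE addrA eab.
by rewrite kab aE -eab -addrA [a2 + e]addrC.
Qed.

Lemma sr_leP (M : nmodType) (b : M) (m : nat) :
  (0 < m)%N -> sr_cond b m ->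
  exists k : nat, [/\ sr b = k%:Z%:E, (0 < k)%N, (k <= m)%N & sr_cond b k].
Proof.
move=> m0 cm.
have exm : exists k, `[< (0 < k)%N /\ sr_cond b k >] by exists m; apply/asboolP.
case: (ex_minnP exm) => k /asboolP[k0 ck] kmin; exists k; split=> //.
  apply/sr_finP; split=> // j j0 cj; apply: kmin; exact/asboolP.
by apply: kmin; apply/asboolP.
Qed.

Lemma ceil_div_nat_le (p l q : nat) : (0 < l)%N ->
  (Num.ceil (p%:Q / l%:R) <= q%:Z) = (p <= q * l)%N.
Proof.
move=> l0; rewrite ceil_le_int ler_pdivrMr ?ltr0n // !pmulrn.
by rewrite -intrM ler_int lez_nat.
Qed.

Lemma floor_div_nat_lt (p l q : nat) : (0 < l)%N ->
  (Num.floor (p%:Q / l%:R) < q%:Z) = (p < q * l)%N.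
Proof.
move=> l0; rewrite floor_lt_int ltr_pdivrMr ?ltr0n // !pmulrn.
by rewrite -intrM ltr_int ltz_nat.
Qed.

Theorem theoremB (M : nmodType) (a : M) (n : int) (srn : sr a = n%:E) :
  (forall l : nat, (0 < l)%N ->
     ((1 + Num.floor ((n - 1)%:Q / l%:R))%R%:E <= sr (a *+ l))%E /\
     (sr (a *+ l) <= (1 + Num.ceil ((n - 1)%:Q / l%:R))%R%:E)%E) /\
  (refinement_monoid M ->
   forall l : nat, (0 < l)%N ->
     sr (a *+ l) = (1 + Num.ceil ((n - 1)%:Q / l%:R))%:E).
Proof.
have [p np [_ ca mina]] : exists2 p : nat, n = p.+1%:Z &
    [/\ (0 < p.+1)%N, sr_cond a p.+1
      & forall m : nat, (0 < m)%N -> sr_cond a m -> (p.+1 <= m)%N].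
  move: (srn); rewrite /sr; case: pselect => // exn.
  case: ex_minnP => -[|p] /asboolP[//] _ _ _ [np]; exists p => //.
  by apply/sr_finP; rewrite srn np.
have -> : n - 1 = p by rewrite np -addn1 PoszD addrK.
(* The upper bound for both halves; the condition at the exact value [q.+1] lets minimality of
   [p.+1] bound [q] from below. *)
have sr_up (l : nat) : (0 < l)%N -> exists q : nat,
    [/\ sr (a *+ l) = q.+1%:Z%:E, q%:Z <= Num.ceil (p%:Q / l%:R)
      & sr_cond (a *+ l) q.+1].
  (* As [p / l] is nonnegative, its ceiling is a natural number [c]. *)
  move=> l0; case ceilE: (Num.ceil (p%:Q / l%:R)) => [c|c]; last first.
    have : 0 <= Num.ceil (p%:Q / l%:R).
      by rewrite ceil_ge0 (lt_le_trans (ltrN10 _)) // divr_ge0 ?ler0n ?ler0z.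
    by rewrite ceilE.
  have pc : (p.+1 <= (c * l).+1)%N by rewrite ltnS -ceil_div_nat_le // ceilE.
  have /(sr_leP (ltn0Sn _))[] := sr_cond_mulrn l0 (sr_cond_leq pc ca).
  by case=> [[]//|q] [srq _ qc cq]; exists q.
split=> [l l0|refM l l0]; have [q [-> qle cq]] := sr_up l l0.
  rewrite !lee_fin intS !lerD2l; split=> //.
  (* The floor is at most [q] iff [p < q.+1 * l], that is, [p.+1 <= q.+1 * l]. *)
  rewrite -ltzD1 addrC -intS floor_div_nat_lt //.
  by apply: mina; [rewrite muln_gt0 | exact: sr_cond_of_mulrn].
rewrite intS; congr (_ + _)%:E; apply/le_anti; rewrite qle /=.
(* The ceiling is at most [q] iff [p.+1 <= (q * l).+1]. *)
rewrite ceil_div_nat_le // -ltnS; apply: mina => //.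
exact: refinement_sr_cond_of_mulrn.
Qed.
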